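(* Let $L$ be a finite dimensional Lie algebra over a field. Then all CP covers of $L$ are isomorphic (as Lie algebras).
   Context: All Lie algebras are over a fixed field. For a Lie algebra $C$, $Z(C)$ is its center, $C^2=[C,C]$ is its derived subalgebra, and $K(C)=\{[x,y] \mid x,y\in C\}$ is the set of all commutators. A pair of Lie algebras $(C,\tilde{B_0})$, with $\tilde{B_0}$ contained in $C$, is a commutativity preserving defining pair (CP defining pair) for $L$ if (i) $L\cong C/\tilde{B_0}$; (ii) $\tilde{B_0}\subseteq Z(C)\cap C^2$; (iii) $\tilde{B_0}\cap K(C)=0$. The pair is a maximal CP defining pair for $L$ if $\dim C$ is maximal among all CP defining pairs for $L$. If $(C,\tilde{B_0})$ is a maximal CP defining pair for $L$, then $C$ is called a commutativity preserving cover (CP cover) of $L$. *)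

(* Defs.v *)
From HB Require Import structures.
From mathcomp Require Import all_boot all_algebra.

Set Implicit Arguments.
Unset Strict Implicit.
Unset Printing Implicit Defensive.

Import GRing.Theory.
Local Open Scope ring_scope.

HB.mixin Record isLie (F : fieldType) V of GRing.Lmodule F V := {
  bracket : V -> V -> V;
  bracket_linearl : forall y : V, linear (bracket^~ y);
  bracket_linearr : forall x : V, linear (bracket x);
  bracketxx : forall x : V, bracket x x = 0;
  bracket_jacobi : forall x y z : V,
    bracket x (bracket y z) + bracket y (bracket z x)
      + bracket z (bracket x y) = 0
}.

(* No bound on the dimension. *)
#[short(type="lieAlgType")]
HB.structure Definition LieAlgebra (F : fieldType) :=
  {V of isLie F V & GRing.Lmodule F V}.

#[short(type="finLieAlgType")]
HB.structure Definition FinLieAlgebra (F : fieldType) :=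
  {V of LieAlgebra F V & Vector F V}.

Notation "[ 'lie' x , y ]" := (bracket x y)
  (at level 0, x, y at level 99, format "[ 'lie'  x ,  y ]") : ring_scope.

Definition lie_isomorphic (F : fieldType) (L M : lieAlgType F) : Prop :=
  exists f : {linear L -> M},
    bijective f /\ {morph f : x y / [lie x, y] >-> [lie x, y]}.

(* By antisymmetry of the bracket, stability on one side is enough. *)
Record lieIdeal (F : fieldType) (C : lieAlgType F) := LieIdeal {
  lie_ideal_pred :> {pred C};
  lie_ideal_submod : submod_closed lie_ideal_pred;
  lie_ideal_bracket :
    forall x y : C, y \in lie_ideal_pred -> [lie x, y] \in lie_ideal_pred
}.

HB.instance Definition _ (F : fieldType) (C : lieAlgType F) (B : lieIdeal C) :=
  GRing.isSubmodClosed.Build F C (lie_ideal_pred B) (lie_ideal_submod B).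

Section BracketTheory.
Variables (F : fieldType) (C : lieAlgType F).
Implicit Types x y z : C.

Lemma bracketDl x y z : [lie x + y, z] = [lie x, z] + [lie y, z].
Proof. by have := bracket_linearl z 1 x y; rewrite !scale1r. Qed.

Lemma bracketDr x y z : [lie x, y + z] = [lie x, y] + [lie x, z].
Proof. by have := bracket_linearr x 1 y z; rewrite !scale1r. Qed.

Lemma bracket0l x : [lie 0, x] = 0.
Proof. by apply: (addrI [lie 0, x]); rewrite -bracketDl !addr0. Qed.

Lemma bracket0r x : [lie x, 0] = 0.
Proof. by apply: (addrI [lie x, 0]); rewrite -bracketDr !addr0. Qed.

Lemma bracketZl a x y : [lie a *: x, y] = a *: [lie x, y].
Proof. by have := bracket_linearl y a x 0; rewrite bracket0l !addr0. Qed.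

Lemma bracketZr a x y : [lie x, a *: y] = a *: [lie x, y].
Proof. by have := bracket_linearr x a y 0; rewrite bracket0r !addr0. Qed.

Lemma bracketNl x y : [lie - x, y] = - [lie x, y].
Proof. by rewrite -scaleN1r bracketZl scaleN1r. Qed.

Lemma bracketNr x y : [lie x, - y] = - [lie x, y].
Proof. by rewrite -scaleN1r bracketZr scaleN1r. Qed.

Lemma bracketC x y : [lie x, y] = - [lie y, x].
Proof.
have := bracketxx (x + y).
rewrite bracketDl !bracketDr !bracketxx add0r addr0 => /eqP.
by rewrite addr_eq0 => /eqP.
Qed.

End BracketTheory.

Definition lie_quot (F : fieldType) (C : lieAlgType F) (B : lieIdeal C) :=
  Quotient.quot (lie_ideal_pred B).

Section LieQuotient.
Variables (F : fieldType) (C : lieAlgType F) (B : lieIdeal C).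
Local Notation Q := (lie_quot B).
Local Open Scope quotient_scope.

HB.instance Definition _ := GRing.Zmodule.on Q.

Definition lie_pi (x : C) : Q := \pi_(Quotient.quot (lie_ideal_pred B)) x.

Definition lie_repr (u : Q) : C := repr (u : Quotient.quot (lie_ideal_pred B)).

Lemma lie_piP (x y : C) : lie_pi x = lie_pi y <-> x - y \in B.
Proof.
by rewrite Quotient.idealrBE; split=> [/eqP //|/eqP].
Qed.

Lemma lie_pi0 : lie_pi 0 = 0.
Proof. exact: raddf0. Qed.

Lemma lie_piD x y : lie_pi (x + y) = lie_pi x + lie_pi y.
Proof. exact: raddfD. Qed.

Lemma lie_reprK (u : Q) : lie_pi (lie_repr u) = u.
Proof. exact: reprK. Qed.

Lemma lie_quotW (P : Q -> Prop) : (forall x, P (lie_pi x)) -> forall u, P u.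
Proof. by move=> Ppi u; rewrite -(lie_reprK u). Qed.

Definition lie_quot_scale (a : F) (u : Q) : Q :=
  lie_pi (a *: lie_repr u).

Definition lie_quot_bracket (u v : Q) : Q :=
  lie_pi [lie lie_repr u, lie_repr v].

Lemma lie_quot_scaleE a x : lie_quot_scale a (lie_pi x) = lie_pi (a *: x).
Proof.
by apply/lie_piP; rewrite -scalerBr rpredZ //; apply/lie_piP/lie_reprK.
Qed.

Lemma lie_quot_bracketE x y :
  lie_quot_bracket (lie_pi x) (lie_pi y) = lie_pi [lie x, y].
Proof.
apply/lie_piP; set x' := lie_repr _; set y' := lie_repr _.
have Bx : x' - x \in B by apply/lie_piP/lie_reprK.
have By : y' - y \in B by apply/lie_piP/lie_reprK.
have ->: [lie x', y'] - [lie x, y] = [lie x', y' - y] - [lie y, x' - x].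
  rewrite !bracketDr !bracketNr (bracketC y x') (bracketC y x) !opprK.
  by rewrite opprD opprK addrA subrK.
by rewrite rpredB //; apply: lie_ideal_bracket.
Qed.

Fact lie_quot_scalerA a b u :
  lie_quot_scale a (lie_quot_scale b u) = lie_quot_scale (a * b) u.
Proof. by move: u; apply: lie_quotW => x; rewrite !lie_quot_scaleE scalerA. Qed.

Fact lie_quot_scale1r : left_id 1 lie_quot_scale.
Proof. by apply: lie_quotW => x; rewrite lie_quot_scaleE scale1r. Qed.

Fact lie_quot_scalerDr : right_distributive lie_quot_scale +%R.
Proof.
move=> a; apply: lie_quotW => x; apply: lie_quotW => y.
by rewrite -lie_piD !lie_quot_scaleE scalerDr lie_piD.
Qed.

Fact lie_quot_scalerDl u : {morph lie_quot_scale^~ u : a b / a + b}.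
Proof.
move: u; apply: lie_quotW => x a b.
by rewrite !lie_quot_scaleE scalerDl lie_piD.
Qed.

HB.instance Definition _ :=
  GRing.Zmodule_isLmodule.Build F Q lie_quot_scalerA lie_quot_scale1r
    lie_quot_scalerDr lie_quot_scalerDl.

Lemma lie_piZ a x : lie_pi (a *: x) = a *: lie_pi x.
Proof. by rewrite -lie_quot_scaleE. Qed.

Fact lie_quot_bracket_linearl v : linear (lie_quot_bracket^~ v).
Proof.
move: v; apply: lie_quotW => z a; apply: lie_quotW => x; apply: lie_quotW => y.
by rewrite -lie_piZ -lie_piD !lie_quot_bracketE bracketDl bracketZl
           lie_piD lie_piZ.
Qed.

Fact lie_quot_bracket_linearr u : linear (lie_quot_bracket u).
Proof.
move: u; apply: lie_quotW => z a; apply: lie_quotW => x; apply: lie_quotW => y.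
by rewrite -lie_piZ -lie_piD !lie_quot_bracketE bracketDr bracketZr
           lie_piD lie_piZ.
Qed.

Fact lie_quot_bracketuu u : lie_quot_bracket u u = 0.
Proof.
by move: u; apply: lie_quotW => x; rewrite lie_quot_bracketE bracketxx lie_pi0.
Qed.

Fact lie_quot_jacobi u v w :
  lie_quot_bracket u (lie_quot_bracket v w)
    + lie_quot_bracket v (lie_quot_bracket w u)
    + lie_quot_bracket w (lie_quot_bracket u v) = 0.
Proof.
move: u v w; apply: lie_quotW => x; apply: lie_quotW => y.
apply: lie_quotW => z.
by rewrite !lie_quot_bracketE -!lie_piD bracket_jacobi lie_pi0.
Qed.

HB.instance Definition _ :=
  isLie.Build F Q lie_quot_bracket_linearl lie_quot_bracket_linearr
    lie_quot_bracketuu lie_quot_jacobi.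

Fact lie_pi_linear : linear lie_pi.
Proof. by move=> a x y; rewrite lie_piD lie_piZ. Qed.

HB.instance Definition _ := GRing.isLinear.Build F C Q _ lie_pi lie_pi_linear.

Lemma lie_pi_bracket x y : lie_pi [lie x, y] = [lie lie_pi x, lie_pi y].
Proof. by rewrite -lie_quot_bracketE. Qed.

End LieQuotient.

Section CPPairs.
Variable F : fieldType.

Definition lie_center (C : lieAlgType F) (x : C) : Prop :=
  forall y : C, [lie x, y] = 0.

Definition commutator (C : lieAlgType F) (z : C) : Prop :=
  exists x y : C, z = [lie x, y].

(* [C, C] is the linear span of the set of commutators, which is in general
   not itself a subspace. *)
Definition lie_derived (C : lieAlgType F) (z : C) : Prop :=
  exists (n : nat) (a : 'I_n -> F) (k : 'I_n -> C),
    (forall i, commutator (k i)) /\ z = \sum_(i < n) a i *: k i.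

Definition lin_indep (V : lmodType F) (n : nat) (v : 'I_n -> V) : Prop :=
  forall a : 'I_n -> F,
    \sum_(i < n) a i *: v i = 0 -> forall i, a i = 0.

(* dim V <= dim W, each dimension being the supremum in N u {+oo} of the sizes
   of the finite linearly independent families. *)
Definition dim_le (V W : lmodType F) : Prop :=
  forall n : nat, (exists v : 'I_n -> V, lin_indep v) ->
    exists w : 'I_n -> W, lin_indep w.

Definition cp_defining_pair (L C : lieAlgType F) (B : lieIdeal C) : Prop :=
  [/\ lie_isomorphic L (lie_quot B),
      forall x : C, x \in B -> lie_center x /\ lie_derived x
    & forall x : C, x \in B -> commutator x -> x = 0].

Definition maximal_cp_defining_pair (L C : lieAlgType F) (B : lieIdeal C) :
    Prop :=
  cp_defining_pair L B /\
  forall (C' : lieAlgType F) (B' : lieIdeal C'),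
    cp_defining_pair L B' -> dim_le C' C.

Definition cp_cover (L C : lieAlgType F) : Prop :=
  exists B : lieIdeal C, maximal_cp_defining_pair L B.

End CPPairs.

(* Main.v *)
(* Let p1 : C1 -> L and p2 : C2 -> L be two CP covers, and P their fibre product
   over L. The kernel N = ker p1 x ker p2 of P -> L is central, but in general
   not contained in P^2. Removing from P a complement of N :&: P^2 in N yields
   a subalgebra D containing P^2, with D^2 = P^2, whose kernel over L is
   N :&: P^2; so D is again a CP extension of L. As ker pi lies in Ci^2 and
   brackets only depend on classes modulo central elements, D maps onto both
   C1 and C2; by maximality of dim C1 and dim C2 both maps are isomorphisms. *)
Require Import Defs.
From HB Require Import structures.
From mathcomp Require Import all_boot all_algebra.
From Stdlib Require Import Classical.

Set Implicit Arguments.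
Unset Strict Implicit.
Unset Printing Implicit Defensive.

Import GRing.Theory.
Local Open Scope ring_scope.

(** * Finite spanning families, bases and dimension *)

Section FiniteDimension.
Variable F : fieldType.

(** Stated for bare modules, since covers are not known in advance to be finite dimensional; an
    arbitrary finite index type allows the sum type used in [cp_extension_finite]. *)
Definition in_span (V : lmodType F) (I : finType) (v : I -> V) (x : V) : Prop :=
  exists a : I -> F, x = \sum_i a i *: v i.

Section Span.
Variables (V : lmodType F) (I : finType) (v : I -> V).

Lemma in_span0 : in_span v 0.
Proof. by exists (fun=> 0); rewrite big1 // => i _; rewrite scale0r. Qed.

Lemma in_spanD x y : in_span v x -> in_span v y -> in_span v (x + y).
Proof.
move=> [a ->] [b ->]; exists (fun i => a i + b i).
by rewrite -big_split; apply: eq_bigr => i _; rewrite scalerDl.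
Qed.

Lemma in_spanZ c x : in_span v x -> in_span v (c *: x).
Proof.
move=> [a ->]; exists (fun i => c * a i).
by rewrite scaler_sumr; apply: eq_bigr => i _; rewrite scalerA.
Qed.

Lemma in_span_sum (J : finType) (w : J -> V) :
  (forall j, in_span v (w j)) -> in_span v (\sum_j w j).
Proof.
move=> vw; apply: (big_ind (in_span v)) => [|x y|j _]; last exact: vw.
  exact: in_span0.
exact: in_spanD.
Qed.

Lemma in_span_gen i : in_span v (v i).
Proof.
exists (fun j => (j == i)%:R).
rewrite (bigD1 i) //= eqxx scale1r big1 ?addr0 //.
by move=> j /negPf ->; rewrite scale0r.
Qed.

End Span.

(** Induction on the size of the family: a nontrivial relation makes one vector redundant, and it is
    discarded. *)
Lemma spanning_basis (V : lmodType F) m (v : 'I_m -> V) :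
  (forall x, in_span v x) ->
  exists n (w : 'I_n -> V), (forall x, in_span w x) /\ lin_indep w.
Proof.
elim: m v => [|m IHm] v spv.
  by exists 0%N, v; split=> // a _ [].
have [iv | /not_all_ex_not [a]] := classic (lin_indep v).
  by exists m.+1, v.
move=> na; have [a0 /not_all_ex_not [j /eqP aj]] := imply_to_and _ _ na.
apply: (IHm (fun i => v (lift j i))) => x; have [b ->] := spv x.
(* The relation is solved for [v j], whose coefficient is nonzero. *)
have vj : v j = \sum_i (- (a j)^-1 * a (lift j i)) *: v (lift j i).
  apply: (scalerI aj); rewrite scaler_sumr.
  move/eqP: a0; rewrite (bigD1_ord j) //= addr_eq0 => /eqP ->.
  rewrite -sumrN; apply: eq_bigr => i _.
  by rewrite scalerA mulrA mulrN divff // mulN1r scaleNr.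
rewrite (bigD1_ord j) //= vj; apply: in_spanD.
  by apply/in_spanZ/in_span_sum => i; apply/in_spanZ/in_span_gen.
by apply/in_span_sum => i; apply/in_spanZ/in_span_gen.
Qed.

Lemma basis_vector_axiom (V : lmodType F) n (w : 'I_n -> V) :
  (forall x, in_span w x) -> lin_indep w -> Vector.axiom n V.
Proof.
move=> spw iw; pose g (r : 'rV[F]_n) := \sum_i r 0 i *: w i.
(* Boolean equality lets [xchoose] pick the coordinates of [x]; independence makes them unique, so
   the choice is linear. *)
have gP x : exists r, g r == x.
  have [a ->] := spw x; exists (\row_i a i); apply/eqP.
  by apply: eq_bigr => i _; rewrite mxE.
have gL : linear g.
  move=> a r s; rewrite /g scaler_sumr -big_split; apply: eq_bigr => i _.
  by rewrite !mxE scalerDl scalerA.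
have gI : injective g.
  move=> r s grs; apply/rowP => i; apply/eqP; rewrite -subr_eq0; apply/eqP.
  apply: (iw (fun i => r 0 i - s 0 i)); transitivity (g r - g s).
    rewrite /g -sumrB; apply: eq_bigr => j _; exact: scalerBl.
  by rewrite grs subrr.
pose f x := xchoose (gP x).
have fK : cancel f g by move=> x; apply/eqP/(xchooseP (gP x)).
have gK : cancel g f by move=> r; apply: gI; rewrite fK.
exists f; last by exists g.
by move=> a x y; apply: gI; rewrite gL !fK.
Qed.

(** The conclusion is an equality of structures, not an isomorphism, so that [C] can later be
    replaced outright by a finite dimensional algebra. *)
Lemma finLie_of_span (C : lieAlgType F) (I : finType) (v : I -> C) :
  (forall x, in_span v x) ->
  exists C' : finLieAlgType F, (C' : lieAlgType F) = C.
Proof.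
move=> spv; have spv' x : in_span (fun i : 'I_#|I| => v (enum_val i)) x.
  have [a ->] := spv x; exists (fun i => a (enum_val i)).
  exact: (reindex _ (onW_bij _ (@enum_val_bij I))).
have [n [w [spw iw]]] := spanning_basis spv'.
pose ax := Lmodule_hasFinDim.Build F C (basis_vector_axiom spw iw).
pose C' : finLieAlgType F := HB.pack (LieAlgebra.sort C) ax.
(* Once [C] is destructed, the repacked structure has the same components. *)
exists C'; rewrite {}/C'; move: ax; clear; by case: C => T [].
Qed.

Lemma dim_le_dimv (V W : vectType F) : dim_le V W -> (\dim {:V} <= \dim {:W})%N.
Proof.
(* [dim_le] is tested on a basis of [V]. *)
move=> leVW; have [w iw] : exists w : 'I_(\dim {:V}) -> W, lin_indep w.
  apply: leVW; exists (fun i => (vbasis {:V})`_i).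
  by apply/freeP; exact: basis_free (vbasisP _).
have : free [tuple w i | i < \dim {:V}].
  apply/freeP => a a0; apply: iw; rewrite -[RHS]a0.
  by apply: eq_bigr => i _; rewrite -tnth_nth tnth_mktuple.
move/eqP; rewrite size_tuple => <-; exact/dimvS/subvf.
Qed.

End FiniteDimension.

(** * Quotients described by surjective morphisms *)

Section LieMorphisms.
Variable F : fieldType.

Lemma linear_factor (V W U : lmodType F) (p : {linear V -> W})
    (q : {linear V -> U}) :
  (forall w, exists v, p v = w) -> (forall v, p v = 0 -> q v = 0) ->
  exists g : {linear W -> U}, forall v, g (p v) = q v.
Proof.
move=> p_onto kpq.
have p_ontob w : exists v, p v == w.
  by have [v <-] := p_onto w; exists v.
(* The choice of preimage is harmless: two preimages differ by an element of [ker p], which [q]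
   kills. *)
pose g w := q (xchoose (p_ontob w)).
have gE v : g (p v) = q v.
  apply/eqP; rewrite -subr_eq0 -raddfB; apply/eqP/kpq.
  by rewrite raddfB /= (eqP (xchooseP (p_ontob (p v)))) subrr.
have gL : linear g.
  move=> a w w'; have [v <-] := p_onto w; have [v' <-] := p_onto w'.
  by rewrite -linearP !gE linearP.
pose gl : {linear W -> U} := HB.pack g (GRing.isLinear.Build F W U _ g gL).
by exists gl.
Qed.

(** Both targets are the quotient of [D] by the same kernel; the two factorizations are inverse to
    each other. *)
Lemma lie_isomorphic_of_ker (D A A' : lieAlgType F) (p : {linear D -> A})
    (q : {linear D -> A'}) :
  {morph p : x y / [lie x, y]} -> {morph q : x y / [lie x, y]} ->
  (forall a, exists d, p d = a) -> (forall a, exists d, q d = a) ->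
  (forall d, p d = 0 <-> q d = 0) -> lie_isomorphic A A'.
Proof.
move=> pM qM p_onto q_onto kpq.
have [g gE] := linear_factor p_onto (fun d => (kpq d).1).
have [h hE] := linear_factor q_onto (fun d => (kpq d).2).
exists g; split.
  exists h => x; first by have [d <-] := p_onto x; rewrite gE hE.
  by have [d <-] := q_onto x; rewrite hE gE.
move=> x y; have [d <-] := p_onto x; have [e <-] := p_onto y.
by rewrite -pM !gE qM.
Qed.

Lemma lie_isomorphic_sym (A A' : lieAlgType F) :
  lie_isomorphic A A' -> lie_isomorphic A' A.
Proof.
move=> [f [fbij fM]]; have [g fK gK] := fbij.
apply: (@lie_isomorphic_of_ker A A' A f idfun) => // [a|a|x].
- by exists (g a).
- by exists a.
- split=> /= [fx0|->]; last exact: raddf0.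
  by apply: (can_inj fK); rewrite fx0 raddf0.
Qed.

(** A CP defining pair seen as a surjection onto [L], with the kernel in the role of the ideal;
    fibre products can then be formed without quotient types. *)
Definition cp_extension (L C : lieAlgType F) (p : {linear C -> L}) : Prop :=
  [/\ {morph p : x y / [lie x, y]}, forall l, exists x, p x = l,
      forall x, p x = 0 -> lie_center x /\ lie_derived x
    & forall x, p x = 0 -> commutator x -> x = 0].

Lemma cp_extension_of_pair (L C : lieAlgType F) (B : lieIdeal C) :
  cp_defining_pair L B -> exists p : {linear C -> L}, cp_extension p.
Proof.
move=> [/lie_isomorphic_sym [f [[g fK gK] fM]] Bcd Bc].
pose p : {linear C -> L} := f \o @lie_pi F C B.
have kp x : p x = 0 -> x \in B.
  move=> px0; rewrite -[x]subr0; apply/lie_piP.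
  by apply: (can_inj fK); rewrite lie_pi0 raddf0.
exists p; split=> [x y|l|x /kp|x /kp].
- by rewrite /p /= lie_pi_bracket fM.
- by exists (lie_repr (g l)); rewrite /p /= lie_reprK gK.
- exact: Bcd.
- exact: Bc.
Qed.

Lemma cp_extension_pair (L C : lieAlgType F) (p : {linear C -> L}) :
  cp_extension p -> exists B : lieIdeal C, cp_defining_pair L B.
Proof.
move=> [pM p_onto pcd pc].
have kS : submod_closed [pred x | p x == 0].
  split=> [|a x y]; rewrite !inE ?raddf0 // => /eqP px /eqP py.
  by rewrite linearP /= px py scaler0 addr0.
have kB (x y : C) :
    y \in [pred x | p x == 0] -> [lie x, y] \in [pred x | p x == 0].
  by rewrite !inE pM => /eqP ->; rewrite bracket0r.
pose B := LieIdeal kS kB; exists B.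
have BE x : (x \in B) = (p x == 0) by [].
split=> [|x|x]; rewrite ?BE; try by move/eqP; auto.
apply: (@lie_isomorphic_of_ker C L _ p (@lie_pi F C B)) => // [x y|u|x].
- exact: lie_pi_bracket.
- by exists (lie_repr u); apply: lie_reprK.
- suff: p x = 0 <-> lie_pi B x = lie_pi B 0 by rewrite lie_pi0.
  by rewrite lie_piP subr0 BE; split=> /eqP.
Qed.

End LieMorphisms.

(** * The direct product of two Lie algebras *)

Section LieProduct.
Variables (F : fieldType) (A B : lieAlgType F).

Definition lie_prod_bracket (x y : A * B) : A * B :=
  ([lie x.1, y.1], [lie x.2, y.2]).

Fact lie_prod_linearl y : linear (lie_prod_bracket^~ y).
Proof. by move=> a x z; congr (_, _); rewrite /= bracketDl bracketZl. Qed.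

Fact lie_prod_linearr x : linear (lie_prod_bracket x).
Proof. by move=> a y z; congr (_, _); rewrite /= bracketDr bracketZr. Qed.

Fact lie_prodxx x : lie_prod_bracket x x = 0.
Proof. by congr (_, _); rewrite bracketxx. Qed.

Fact lie_prod_jacobi x y z :
  lie_prod_bracket x (lie_prod_bracket y z)
    + lie_prod_bracket y (lie_prod_bracket z x)
    + lie_prod_bracket z (lie_prod_bracket x y) = 0.
Proof. by congr (_, _); rewrite /= bracket_jacobi. Qed.

HB.instance Definition _ := isLie.Build F (A * B)%type lie_prod_linearl
  lie_prod_linearr lie_prodxx lie_prod_jacobi.

End LieProduct.

HB.instance Definition _ (F : fieldType) (A B : finLieAlgType F) :=
  Vector.on (A * B)%type.

(** * Subalgebras of a finite dimensional Lie algebra *)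

Section LieSubalgebra.
Variables (F : fieldType) (T : finLieAlgType F) (D : {vspace T}).
Hypothesis DM : forall x y, x \in D -> y \in D -> [lie x, y] \in D.

(** The closure proof is a parameter of the type, so that the Lie structure can be attached to it
    canonically. *)
Definition lie_subvs of (forall x y, x \in D -> y \in D -> [lie x, y] \in D) :=
  subvs_of D.
Local Notation S := (lie_subvs DM).

HB.instance Definition _ := Vector.on S.

(** By closure the bracket already lies in [D], where the projection [vsproj] changes nothing. *)
Definition lie_subvs_bracket (u v : S) : S := vsproj D [lie vsval u, vsval v].

Lemma vsval_lie_bracket u v :
  vsval (lie_subvs_bracket u v) = [lie vsval u, vsval v].
Proof. by rewrite vsprojK // DM // subvsP. Qed.

Fact lie_subvs_linearl v : linear (lie_subvs_bracket^~ v).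
Proof.
move=> a x y; apply/val_inj.
by rewrite /= !vsval_lie_bracket /= bracketDl bracketZl.
Qed.

Fact lie_subvs_linearr u : linear (lie_subvs_bracket u).
Proof.
move=> a x y; apply/val_inj.
by rewrite /= !vsval_lie_bracket /= bracketDr bracketZr.
Qed.

Fact lie_subvsxx u : lie_subvs_bracket u u = 0.
Proof. by apply/val_inj; rewrite /= vsval_lie_bracket bracketxx. Qed.

Fact lie_subvs_jacobi u v w :
  lie_subvs_bracket u (lie_subvs_bracket v w)
    + lie_subvs_bracket v (lie_subvs_bracket w u)
    + lie_subvs_bracket w (lie_subvs_bracket u v) = 0.
Proof.
by apply/val_inj; rewrite /= !vsval_lie_bracket bracket_jacobi.
Qed.

HB.instance Definition _ := isLie.Build F S lie_subvs_linearl
  lie_subvs_linearr lie_subvsxx lie_subvs_jacobi.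

End LieSubalgebra.

(** * Brackets modulo the center, derived subalgebras and complements *)

Section BracketSpan.
Variable F : fieldType.

Lemma bracket_suml (C : lieAlgType F) I (r : seq I) (f : I -> C) y :
  [lie \sum_(i <- r) f i, y] = \sum_(i <- r) [lie f i, y].
Proof.
apply: (big_morph (fun x => [lie x, y])) => [x z|]; first exact: bracketDl.
exact: bracket0l.
Qed.

Lemma bracket_sumr (C : lieAlgType F) I (r : seq I) x (f : I -> C) :
  [lie x, \sum_(i <- r) f i] = \sum_(i <- r) [lie x, f i].
Proof.
apply: (big_morph (fun y => [lie x, y])) => [y z|]; first exact: bracketDr.
exact: bracket0r.
Qed.

Lemma bracketDcenter (C : lieAlgType F) (x y z t : C) :
  lie_center z -> lie_center t -> [lie x + z, y + t] = [lie x, y].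
Proof.
move=> zc tc; rewrite bracketDl zc addr0 bracketDr.
by rewrite (bracketC x t) tc oppr0 addr0.
Qed.

(** Lifts [c i] of a basis of [L] span [C] modulo the kernel. The kernel is central and consists of
    combinations of brackets, and these only see the classes modulo the kernel; so the [c i] and
    their brackets span [C]. *)
Lemma cp_extension_finite (L : finLieAlgType F) (C : lieAlgType F)
    (p : {linear C -> L}) :
  cp_extension p -> exists C' : finLieAlgType F, (C' : lieAlgType F) = C.
Proof.
move=> [pM p_onto pcd _]; pose n := \dim {:L}; pose e := vbasis {:L}.
have [c cE] : exists c : 'I_n -> C, forall i, p (c i) = e`_i.
  have ex i : exists x, p x == e`_i by have [x <-] := p_onto e`_i; exists x.
  by exists (fun i => xchoose (ex i)) => i; apply/eqP/(xchooseP (ex i)).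
have dec x : exists (a : 'I_n -> F) z, p z = 0 /\ x = \sum_i a i *: c i + z.
  exists (fun i => coord e i (p x)), (x - \sum_i coord e i (p x) *: c i).
  split; last by rewrite addrC subrK.
  rewrite raddfB raddf_sum; apply/eqP; rewrite subr_eq0; apply/eqP.
  rewrite [LHS](coord_vbasis (memvf _)); apply: eq_bigr => i _.
  by rewrite /= linearZ /= cE.
pose v (k : 'I_n + 'I_n * 'I_n) :=
  match k with inl i => c i | inr ij => [lie c ij.1, c ij.2] end.
apply: (@finLie_of_span _ _ _ v) => x.
have [a [z [pz ->]]] := dec x; apply: in_spanD.
  by apply: in_span_sum => i; apply/in_spanZ/(in_span_gen v (inl i)).
have [m [b [k [kP ->]]]] := (pcd z pz).2.
apply: in_span_sum => i; apply: in_spanZ; have [{}x [y ->]] := kP i.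
have [{}a [s [/pcd [sc _] ->]]] := dec x.
have [{}b [t [/pcd [tc _] ->]]] := dec y.
rewrite bracketDcenter // bracket_suml; apply: in_span_sum => j.
rewrite bracketZl bracket_sumr; apply/in_spanZ/in_span_sum => l.
by rewrite bracketZr; apply/in_spanZ/(in_span_gen v (inr (j, l))).
Qed.

(** The image of [g] and the kernel of [p] together span [C]. The kernel is itself reached: its
    elements are combinations of brackets, and a bracket is unchanged when its entries are moved
    into the image of [g] by central elements. *)
Lemma cp_extension_lift_onto (L C D : lieAlgType F) (p : {linear C -> L})
    (g : {linear D -> C}) :
  cp_extension p -> {morph g : x y / [lie x, y]} ->
  (forall l, exists d, p (g d) = l) -> forall c, exists d, g d = c.
Proof.
move=> [_ _ pcd _] gM pg_onto c.
have lift x : exists d, lie_center (x - g d) /\ lie_derived (x - g d).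
  have [d pd] := pg_onto (p x); exists d; apply: pcd.
  by rewrite raddfB /= pd subrr.
have [d [_ [n [a [k [kP def_c]]]]]] := lift c.
have kim i : exists e, g e == k i.
  have [x [y ->]] := kP i.
  have [x' [xc _]] := lift x; have [y' [yc _]] := lift y.
  by exists [lie x', y']; rewrite gM -(bracketDcenter _ _ xc yc) !subrKC.
exists (d + \sum_i a i *: xchoose (kim i)).
rewrite raddfD raddf_sum -[RHS](subrKC (g d)) def_c; congr (_ + _).
by apply: eq_bigr => i _; rewrite /= linearZ /= (eqP (xchooseP (kim i))).
Qed.

(** The derived space of [P]; by bilinearity the finitely many brackets of basis vectors suffice. *)
Definition bracketv (T : finLieAlgType F) (P : {vspace T}) : {vspace T} :=
  <<[seq [lie x, y] | x <- vbasis P, y <- vbasis P]>>%VS.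

Lemma memv_bracket (T : finLieAlgType F) (P : {vspace T}) x y :
  x \in P -> y \in P -> [lie x, y] \in bracketv P.
Proof.
move=> Px Py; rewrite (coord_vbasis Px) (coord_vbasis Py) bracket_suml.
apply: memv_suml => i _; rewrite bracketZl bracket_sumr; apply: memvZ.
apply: memv_suml => j _; rewrite bracketZr; apply/memvZ/memv_span.
by apply: allpairs_f; rewrite mem_nth // size_tuple.
Qed.

(** Each generator of [bracketv P] is a bracket of elements of [D], so a combination of them lying
    in [D] is derived within [D] itself. *)
Lemma bracketv_derived (T : finLieAlgType F) (P : {vspace T}) (D : {vspace T})
    (DM : forall x y, x \in D -> y \in D -> [lie x, y] \in D)
    (x : lie_subvs DM) :
  (forall y z, y \in P -> z \in P ->
     exists y' z', [/\ y' \in D, z' \in D & [lie y, z] = [lie y', z']]) ->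
  vsval x \in bracketv P -> lie_derived x.
Proof.
move=> PD; rewrite /bracketv; set X := (X in span X) => Ux.
exists (size X), (fun i => coord (in_tuple X) i (vsval x)).
have XD i : exists y z : lie_subvs DM, X`_i = vsval [lie y, z].
  (* Past the end of [X] the default value 0 is the bracket of 0 with itself. *)
  have [ltiX | leXi] := ltnP i (size X); last first.
    by exists 0, 0; rewrite nth_default // bracketxx.
  have /allpairsP [[y z] /= [Py Pz ->]] := mem_nth 0 ltiX.
  have [y' [z' [Dy' Dz' ->]]] := PD _ _ (vbasis_mem Py) (vbasis_mem Pz).
  exists (Subvs Dy' : lie_subvs DM), (Subvs Dz' : lie_subvs DM).
  by rewrite vsval_lie_bracket.
exists (fun i => vsproj D X`_i); split=> [i|].
  by have [y [z ->]] := XD i; exists y, z; rewrite vsvalK.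
apply/val_inj; rewrite /= [LHS](@coord_span _ _ _ (in_tuple X) _ Ux).
rewrite raddf_sum /=.
apply: eq_bigr => i _; rewrite /= vsprojK //.
by have [y [z ->]] := XD i; exact: subvsP.
Qed.

(** Take [X] complementing [N :&: U] in [N] and [R] complementing [U + X] in [P]. Then [D = U + R]
    omits only [X], which lies in [N]. *)
Lemma relative_complement (V : vectType F) (U N P : {vspace V}) :
  (U <= P)%VS -> (N <= P)%VS ->
  exists D : {vspace V},
    [/\ (U <= D)%VS, (D <= P)%VS, (P <= D + N)%VS & (D :&: N <= U)%VS].
Proof.
move=> sUP sNP; pose X := (N :\: U)%VS; pose R := (P :\: (U + X))%VS.
have sXN : (X <= N)%VS by exact: diffvSl.
exists (U + R)%VS; split; first exact: addvSl.
- by rewrite subv_add sUP diffvSl.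
- rewrite -(addv_diff_cap P (U + X)) subv_add; apply/andP; split.
    by rewrite (subv_trans (addvSr U R)) ?addvSl.
  by rewrite (subv_trans (capvSr _ _)) // addvS ?addvSl.
- apply/subvP => _ /memv_capP [/memv_addP [u Uu [r Rr ->]]].
  rewrite -{1}(addv_diff_cap N U) => /memv_addP [x Xx [w]].
  rewrite memv_cap => /andP [_ Uw] E.
  (* An element [u + r] of [N] is also [x + w] with [w] in [U], so [r] lies in both [U + X] and its
     complement. *)
  suff -> : r = 0 by rewrite addr0.
  apply/eqP; rewrite -memv0 -(capv_diff P (U + X)) memv_cap Rr /=.
  have -> : r = (w - u) + x.
    by rewrite addrAC [w + x]addrC -E [u + r]addrC addrK.
  by rewrite memv_add // memvB.
Qed.

End BracketSpan.

(** * A CP extension dominating two given ones *)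

Section CommonCover.
Variables (F : fieldType) (L C1 C2 : finLieAlgType F).
Variables (p1 : {linear C1 -> L}) (p2 : {linear C2 -> L}).
Hypotheses (ext1 : cp_extension p1) (ext2 : cp_extension p2).
Let T : finLieAlgType F := (C1 * C2)%type.

Lemma common_cp_extension :
  exists (D : finLieAlgType F) (q : {linear D -> L})
      (g1 : {linear D -> C1}) (g2 : {linear D -> C2}),
    [/\ cp_extension q,
        {morph g1 : x y / [lie x, y]}, {morph g2 : x y / [lie x, y]},
        (forall c, exists d, g1 d = c) & (forall c, exists d, g2 d = c)].
Proof.
have [p1M p1_onto p1cd p1c] := ext1; have [p2M p2_onto p2cd p2c] := ext2.
pose r1 : {linear T -> L} := p1 \o fst; pose r2 : {linear T -> L} := p2 \o snd.
(* The fibre product, as the kernel of the difference of the two maps to [L]. *)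
pose P := lker (linfun (r1 \- r2)).
have PE (c : C1) (d : C2) : ((c, d) : T) \in P = (p1 c == p2 d).
  by rewrite memv_ker lfunE /= subr_eq0.
pose N := (lker (linfun r1) :&: lker (linfun r2))%VS.
have NE (c : C1) (d : C2) : ((c, d) : T) \in N = (p1 c == 0) && (p2 d == 0).
  by rewrite memv_cap !memv_ker !lfunE.
have Nc (x : T) : x \in N -> lie_center x.
  case: x => c d; rewrite NE.
  move=> /andP [/eqP /p1cd [cc _] /eqP /p2cd [dc _]] [c' d'].
  by congr (_, _); [exact: cc | exact: dc].
have PM (x y : T) : x \in P -> y \in P -> [lie x, y] \in P.
  case: x y => [c d] [c' d']; rewrite !PE => /eqP e /eqP e'.
  by rewrite p1M p2M e e'.
have sUP : (bracketv P <= P)%VS.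
  apply/span_subvP => _ /allpairsP [[x y] /= [Px Py ->]].
  by apply: PM; exact: vbasis_mem.
have sNP : (N <= P)%VS.
  by apply/subvP => -[c d]; rewrite NE PE => /andP [/eqP -> /eqP ->].
have [D [sUD sDP sPDN sDNU]] := relative_complement sUP sNP.
have DM (x y : T) : x \in D -> y \in D -> [lie x, y] \in D.
  move=> Dx Dy; apply: (subvP sUD); apply: memv_bracket; exact: (subvP sDP).
have PD (x : T) : x \in P -> exists2 x', x' \in D & x - x' \in N.
  move=> /(subvP sPDN) /memv_addP [x' Dx' [n Nn ->]].
  by exists x' => //; rewrite addrC addKr.
(* Every element of [P] is in [D] up to the central space [N], so [P] and [D] have the same
   brackets. *)
have PDM (x y : T) : x \in P -> y \in P ->
    exists x' y', [/\ x' \in D, y' \in D & [lie x, y] = [lie x', y']].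
  move=> /PD [x' Dx' /Nc nx] /PD [y' Dy' /Nc ny]; exists x', y'; split=> //.
  by rewrite -(bracketDcenter x' y' nx ny) !subrKC.
pose g1 : {linear lie_subvs DM -> C1} := fst \o vsval.
pose g2 : {linear lie_subvs DM -> C2} := snd \o vsval.
pose q : {linear lie_subvs DM -> L} := p1 \o g1.
have valM (x y : lie_subvs DM) : vsval [lie x, y] = [lie vsval x, vsval y].
  exact: vsval_lie_bracket.
have g1M : {morph g1 : x y / [lie x, y]} by move=> x y; rewrite /g1 /= valM.
have g2M : {morph g2 : x y / [lie x, y]} by move=> x y; rewrite /g2 /= valM.
have qE x : q x = p2 (g2 x).
  by apply/eqP; rewrite -PE -surjective_pairing (subvP sDP) ?subvsP.
have q_onto l : exists x, q x = l.
  have [c <-] := p1_onto l; have [d pd] := p2_onto (p1 c).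
  (* Moving [(c, d)] into [D] by an element of [N] does not change its image in [L]. *)
  have /PD [[c' d'] Dx] : ((c, d) : T) \in P by rewrite PE pd.
  rewrite NE => /andP [/= + _]; rewrite raddfB subr_eq0 => /eqP ->.
  by exists (Subvs Dx).
have q0 x : q x = 0 -> vsval x \in N.
  move=> qx0; rewrite [vsval x]surjective_pairing NE.
  by rewrite -[p2 _]qE -[p1 _]/(q x) qx0 eqxx.
exists (lie_subvs DM), q, g1, g2; split=> //; last first.
- apply: (cp_extension_lift_onto ext2) => // l.
  by have [x <-] := q_onto l; exists x.
- by apply: (cp_extension_lift_onto ext1).
split=> // [x y|x /q0 Nx|x /q0 Nx [y [z def_x]]].
- exact: etrans (congr1 p1 (g1M x y)) (p1M _ _).
- split; first by move=> y; apply/val_inj; rewrite /= valM Nc.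
  (* The kernel of [q] lies in [D :&: N], hence in the derived space of [P]. *)
  apply: bracketv_derived PDM _; apply: (subvP sDNU).
  by rewrite memv_cap subvsP.
apply/val_inj; rewrite /= [vsval x]surjective_pairing.
move: Nx; rewrite [vsval x]surjective_pairing NE => /andP [/eqP n1 /eqP n2].
(* Each component of a commutator is a commutator in its factor, and there it lies in the kernel of
   [p1] or [p2]. *)
congr (_, _); [apply: p1c => //|apply: p2c => //].
  by exists (g1 y), (g1 z); rewrite -g1M def_x.
by exists (g2 y), (g2 z); rewrite -g2M def_x.
Qed.

End CommonCover.

(** * Maximality and the isomorphism of the covers *)

Lemma lie_onto_maximal_inj (F : fieldType) (D C : finLieAlgType F)
    (g : {linear D -> C}) :
  dim_le D C -> (forall c, exists d, g d = c) -> forall d, g d = 0 -> d = 0.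
Proof.
move=> /dim_le_dimv leDC g_onto d gd0.
have img : limg (linfun g) = fullv.
  apply/eqP; rewrite eqEsubv subvf; apply/subvP => c _.
  by have [x <-] := g_onto c; rewrite -[g x]lfunE memv_img ?memvf.
(* Rank-nullity: since [g] is onto and [D] is no larger than [C], the kernel has dimension 0. *)
have := limg_ker_dim (linfun g) fullv; rewrite img capfv => dimE.
have /eqP : \dim (lker (linfun g)) = 0%N.
  by apply/eqP; rewrite -leqn0 -(leq_add2r (\dim {:C})) dimE.
by rewrite dimv_eq0 => /eqP k0; apply/eqP;
  rewrite -memv0 -k0 memv_ker lfunE gd0.
Qed.

Theorem proposition2p9 (F : fieldType) (L : finLieAlgType F)
    (C1 C2 : lieAlgType F) (hC1 : cp_cover L C1) (hC2 : cp_cover L C2) :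
  lie_isomorphic C1 C2.
Proof.
have [B1 [/cp_extension_of_pair [p1 ext1] max1]] := hC1.
have [B2 [/cp_extension_of_pair [p2 ext2] max2]] := hC2.
have [C1' def1] := cp_extension_finite ext1.
(* Eliminating the equality turns [C1] into a finite dimensional algebra throughout the context. *)
case: C1 / def1 in hC1 B1 p1 ext1 max1 *.
have [C2' def2] := cp_extension_finite ext2.
case: C2 / def2 in hC2 B2 p2 ext2 max2 *.
have [D [q [g1 [g2 [extD g1M g2M g1_onto g2_onto]]]]] :=
  common_cp_extension ext1 ext2.
have [B pairB] := cp_extension_pair extD.
have inj1 := lie_onto_maximal_inj (max1 _ _ pairB) g1_onto.
have inj2 := lie_onto_maximal_inj (max2 _ _ pairB) g2_onto.
(* Both projections of [D] have zero kernel, hence the same kernel. *)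
apply: (lie_isomorphic_of_ker g1M g2M) => // d.
by split=> [/inj1 | /inj2] ->; rewrite raddf0.
Qed.
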